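(* For $i=1,2$ let $R_i,S_i\in L^2(\mathbb T)$ and set $u_i=\mathfrak u(R_i,S_i)$. The following bounds hold. (i) $$\|u_1-u_2\|_{L^\infty(\mathbb T)}\lesssim|F^{-1}|_{\mathrm{Lip}}\big(\|R_1-R_2\|_{L^1(\mathbb T)}+\|S_1-S_2\|_{L^1(\mathbb T)}\big),$$ with an absolute implied constant. (ii) $$\|c(u_1)R_1-c(u_2)R_2\|_{L^2(\mathbb T)}+\|c(u_1)S_1-c(u_2)S_2\|_{L^2(\mathbb T)}\lesssim_\kappa\big(1+\|R_1\|_{L^2}\wedge\|R_2\|_{L^2}+\|S_1\|_{L^2}\wedge\|S_2\|_{L^2}\big)\big(\|R_1-R_2\|_{L^2}+\|S_1-S_2\|_{L^2}\big).$$ (iii) If additionally $R_i,S_i\in H^1(\mathbb T)$ for $i=1,2$, then $$\|c(u_1)\partial_xR_1-c(u_2)\partial_xR_2\|_{L^2}+\|c(u_1)\partial_xS_1-c(u_2)\partial_xS_2\|_{L^2}\lesssim_\kappa\big(1+\|\partial_xR_1\|_{L^2}\wedge\|\partial_xR_2\|_{L^2}+\|\partial_xS_1\|_{L^2}\wedge\|\partial_xS_2\|_{L^2}\big)\big(\|R_1-R_2\|_{H^1}+\|S_1-S_2\|_{H^1}\big).$$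
   Context: $\mathbb T=[0,1]$ with periodic boundary. There is a constant $\kappa>1$ such that $c\in C^1(\mathbb R)$, $c:\mathbb R\to[\kappa^{-1},\kappa]$ and $|c'|\le\kappa$. $F(v):=\int_0^vc(r)\,\mathrm dr$, a bi-Lipschitz bijection of $\mathbb R$; $|F^{-1}|_{\mathrm{Lip}}$ is the Lipschitz constant of $F^{-1}$. For a function $f$ on $\mathbb T$, $$(\partial_x^{-1}f)(x):=\int_0^xf(y)\,\mathrm dy-x\int_{\mathbb T}f(y)\,\mathrm dy-\int_{\mathbb T}\Big[\int_0^yf(z)\,\mathrm dz-y\int_{\mathbb T}f(z)\,\mathrm dz\Big]\mathrm dy,$$ and $\mathfrak u(G,H):=F^{-1}\big(\partial_x^{-1}\tfrac{G-H}2\big)$. The notation $a\wedge b$ means $\min(a,b)$; $\lesssim_\kappa$ means inequality up to a multiplicative constant depending only on $\kappa$. *)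

(* Defs.v *)
From HB Require Import structures.
From mathcomp Require Export all_boot all_order all_algebra.
From mathcomp Require Export all_classical all_reals all_analysis.

Set Implicit Arguments.
Unset Strict Implicit.
Unset Printing Implicit Defensive.

Import Order.TTheory GRing.Theory Num.Theory.
Import numFieldNormedType.Exports.

Local Open Scope classical_set_scope.
Local Open Scope ring_scope.

(* A function on the torus is represented by a map K -> K, of which only the
   values on [0, 1] matter: every notion below restricts to [0, 1]. *)
Section torus.
Context {K : realType}.
Implicit Types (f g phi c : K -> K) (p : \bar K).
Local Notation mu := (@lebesgue_measure K).

Definition torus : set K := `[0, 1].

Definition normL p f : \bar K := 'N[mu]_p[EFin \o (f \_ torus)]%E.

Definition inL2 f : Prop := (f \_ torus) \in Lfun mu 2%:E.

Definition C1 f : Prop := (forall x, derivable f x 1) /\ continuous (derive1 f).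

(* Weak derivative on the torus: since the test functions are 1-periodic rather
   than compactly supported in ]0, 1[, a function with a jump between the
   endpoints has no weak derivative in L^2. *)
Definition is_weak_derivative f g : Prop :=
  forall phi, C1 phi -> (forall x, phi (x + 1) = phi x) ->
    \int[mu]_(x in torus) (f x * derive1 phi x) =
    - \int[mu]_(x in torus) (g x * phi x).

Definition inH1 f : Prop :=
  inL2 f /\ exists g, inL2 g /\ is_weak_derivative f g.

(* A representative of the weak derivative, which is unique up to null sets
   (and the zero function if there is none). *)
Definition weak_derivative f : K -> K :=
  xget (cst 0) [set g | inL2 g /\ is_weak_derivative f g].

Definition normH1 f : \bar K :=
  ((normL 2%:E f `^ 2 + normL 2%:E (weak_derivative f) `^ 2) `^ 2^-1)%E.

Definition lipschitz_constant g : \bar K :=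
  ereal_sup [set (`|g xy.1 - g xy.2| / `|xy.1 - xy.2|)%:E
            | xy in [set xy : K * K | xy.1 != xy.2]].

Definition wave_speed (kappa : K) c : Prop :=
  C1 c /\ forall x, kappa^-1 <= c x <= kappa /\ `|derive1 c x| <= kappa.

Definition F c (v : K) : K :=
  if 0 <= v then \int[mu]_(r in `[0, v]) c r else - \int[mu]_(r in `[v, 0]) c r.

(* For a wave speed [c], the function [F c] is a bijection of K. *)
Definition Finv c : K -> K := 'pinv_(fun=> 0) setT (F c).

Definition antiderivative0 f (x : K) : K :=
  \int[mu]_(y in `[0, x]) f y - x * \int[mu]_(y in torus) f y.

Definition antiderivative f (x : K) : K :=
  antiderivative0 f x - \int[mu]_(y in torus) antiderivative0 f y.

Definition profile c (G H : K -> K) (x : K) : K :=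
  Finv c (antiderivative (fun y => (G y - H y) / 2) x).

End torus.

(* Main.v *)
(** The primitives of [f] and [g] differ on the torus by at most [4 |f - g|_1], and
    [F c] has slope at least [kappa^-1], so that [Finv c] is [kappa]-Lipschitz.  This
    controls [u1 - u2] uniformly, and the product estimates follow from the splitting
    [c(u1) P1 - c(u2) P2 = c(u1) (P1 - P2) + (c(u1) - c(u2)) P2] and its mirror image,
    whichever has the smaller second factor.  For (iii), the weak derivative of
    [R1 - R2] has to be the difference of the chosen representatives: if [h] is
    orthogonal to every periodic C^1 function then, testing with smooth approximations
    of the indicator of [[0, b]], its primitive vanishes, hence so does [h] almost
    everywhere by Lebesgue differentiation. *)

Require Import Defs.
From mathcomp Require Import measurable_realfun ess_sup_inf.
From mathcomp Require Import ring.

Set Implicit Arguments.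
Unset Strict Implicit.
Unset Printing Implicit Defensive.

Import Order.TTheory GRing.Theory Num.Theory.
Import numFieldNormedType.Exports.

Local Open Scope classical_set_scope.
Local Open Scope ring_scope.

(** Both integrals are suprema over simple functions below the integrand, and those below [f] lie
    below [g]. Through [le_normL2] this bounds products [c (u x) * P x] without first proving them
    measurable. *)
Lemma ge0_le_integral_nonmeasurable d (T : measurableType d) (R : realType)
    (mu : {measure set T -> \bar R}) (f g : T -> \bar R) :
  (forall x, 0 <= f x)%E -> (forall x, f x <= g x)%E ->
  (\int[mu]_x f x <= \int[mu]_x g x)%E.
Proof.
move=> f0 fg.
have g0 x : (0 <= g x)%E by exact: le_trans (fg x).
rewrite !ge0_integralTE//; apply: ereal_sup_le => _ [h hf <-].
by exists h => //= x; exact: le_trans (fg x).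
Qed.

(** * L^1 and L^2 norms on the torus *)

Section norms.
Context {K : realType}.
Implicit Types (f g : K -> K).
Local Notation mu := (@lebesgue_measure K).

Lemma measurable_torus : measurable (torus : set (measurableTypeR K)).
Proof. exact: measurable_itv. Qed.

Lemma mu_torus : mu (@torus K) = 1%E.
Proof. by rewrite /torus lebesgue_measure_itv/= lte_fin ltr01 sube0. Qed.

Lemma le_normL2 f g : (forall x, torus x -> `|f x| <= `|g x|) ->
  (normL 2%:E f <= normL 2%:E g)%E.
Proof.
move=> fg; rewrite /normL unlock; apply: gt0_ler_poweR.
- by rewrite invr_ge0.
- by rewrite in_itv/= leey integral_ge0.
- by rewrite in_itv/= leey integral_ge0.
apply: ge0_le_integral_nonmeasurable => x; first by rewrite /= lee_fin powR_ge0.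
rewrite /= lee_fin ge0_ler_powR ?nnegrE// !patchE.
by case: ifPn => // /set_mem; exact: fg.
Qed.

Lemma inL2_measurable f : inL2 f -> measurable_fun setT (f \_ torus).
Proof. by rewrite /inL2 inE => /andP[/[!inE]]. Qed.

Lemma normL2_fin f : inL2 f -> normL 2%:E f \is a fin_num.
Proof.
rewrite /inL2 inE => /andP[_]; rewrite inE/= /finite_norm => h.
by rewrite ge0_fin_numE ?Lnorm_ge0.
Qed.

Lemma restrictD f g (A : set K) : (f \+ g) \_ A = (f \_ A) \+ (g \_ A).
Proof.
apply/funext => x; rewrite !patchE/=.
by case: ifP; rewrite ?addr0 ?patchE => -> //; rewrite addr0.
Qed.

Lemma inL2D f g : inL2 f -> inL2 g -> inL2 (f \+ g).
Proof.
rewrite /inL2 restrictD => hf hg.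
have [_ +] := @Lfun_addr_closed _ _ _ mu 2%:E (lee1n 2).
exact.
Qed.

Lemma inL2Z (a : K) f : inL2 f -> inL2 (fun x => a * f x).
Proof.
rewrite /inL2 => hf.
have -> : (fun x => a * f x) \_ torus = a \o* (f \_ torus).
  by apply/funext => x; rewrite /= !patchE; case: ifP; rewrite ?mul0r// mulrC.
by apply: Lfun_scale => //; rewrite ler1n.
Qed.

Lemma inL2B f g : inL2 f -> inL2 g -> inL2 (f \- g).
Proof.
move=> hf hg; have -> : f \- g = f \+ (fun x => (-1) * g x).
  by apply/funext => x /=; rewrite mulN1r.
by apply: inL2D => //; exact: inL2Z.
Qed.

Lemma normL2D f g : inL2 f -> inL2 g ->
  (normL 2%:E (f \+ g)%R <= normL 2%:E f + normL 2%:E g)%E.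
Proof.
move=> hf hg; rewrite /normL restrictD.
by apply: minkowski_EFin; rewrite ?ler1n//; exact: inL2_measurable.
Qed.

Lemma normL2Z (a : K) f : inL2 f ->
  normL 2%:E (fun x => a * f x)%R = (`|a|%:E * normL 2%:E f)%E.
Proof.
move=> hf; rewrite /normL.
have := LnormZ (Lfun_Sub (lee1n 2) hf) a.
rewrite Lfun_valP => <-; congr Lnorm; apply/funext => x /=.
by rewrite !patchE; case: ifP => // _; rewrite scaler0.
Qed.

Lemma normL1E f : normL 1 f = (\int[mu]_(x in torus) `|f x|%:E)%E.
Proof.
rewrite /normL Lnorm1 [RHS]integral_mkcond; apply: eq_integral => x _.
by rewrite /= !patchE; case: ifP => //; rewrite normr0.
Qed.

(** Hölder's inequality against the indicator of the torus, whose L^2 norm is 1 because the torus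
    has measure 1. *)
Lemma normL1_le_normL2 f : inL2 f -> (normL 1 f <= normL 2%:E f)%E.
Proof.
move=> hf.
have m1 : measurable_fun setT (\1_(@torus K) : K -> K).
  exact: measurable_indic measurable_torus.
have := @hoelder _ _ _ mu (f \_ torus) (\1_torus) 2 2 (inL2_measurable hf) m1.
rewrite -/(normL 2%:E f).
have -> : ((f \_ torus) \* \1_torus)%R = f \_ torus.
  apply/funext => x; rewrite /= indicE !patchE.
  by case: ifP => _; rewrite ?mulr1 ?mul0r.
have -> : 'N[mu]_2%:E[EFin \o \1_torus]%E = 1%E.
  rewrite unlock.
  have -> : (\int[mu]_x `|(EFin \o \1_(@torus K)) x| `^ 2 = 1)%E.
    rewrite -[RHS]mu_torus -[X in _ = mu X]setIT -integral_indic//; last first.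
      exact: measurable_torus.
    apply: eq_integral => x _; rewrite /= !indicE.
    by case: (x \in torus); rewrite ?normr1 ?powR1// normr0 powR0// pnatr_eq0.
  by rewrite poweR1r.
rewrite mule1; apply => //.
by rewrite [RHS]splitr !div1r.
Qed.

Lemma inL2_integrable f : inL2 f -> mu.-integrable torus (EFin \o f).
Proof.
move=> hf; have mf := inL2_measurable hf.
apply/integrableP; split.
  apply/measurable_EFinP/(measurable_restrictT _ measurable_torus) => //.
rewrite -normL1E (le_lt_trans (normL1_le_normL2 hf))//.
by rewrite -ge0_fin_numE ?Lnorm_ge0 ?normL2_fin.
Qed.

End norms.

(** * Slope bounds for [F c], its inverse, and the wave speed *)

Section wave_speed.
Context {K : realType}.
Implicit Types (c : K -> K).
Local Notation mu := (@lebesgue_measure K).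

Lemma C1_continuous c : C1 c -> continuous c.
Proof. by move=> [dc _] x; exact/differentiable_continuous/derivable1_diffP. Qed.

Lemma continuous_integrable c (a b : K) : continuous c ->
  mu.-integrable `[a, b] (EFin \o c).
Proof.
move=> cc; apply: continuous_compact_integrable; first exact: segment_compact.
exact: continuous_subspaceT.
Qed.

Lemma FB c (a b : K) : continuous c -> a <= b ->
  F c b - F c a = \int[mu]_(r in `[a, b]) c r.
Proof.
move=> cc ab; have ci x y : mu.-integrable `[x, y] (EFin \o c).
  exact: continuous_integrable.
have split_itv x y z : x <= y -> y <= z -> \int[mu]_(r in `[x, z]) c r =
    \int[mu]_(r in `[x, y]) c r + \int[mu]_(r in `[y, z]) c r.
  move=> xy yz.
  have := @Rintegral_itvB _ c (BLeft x) (BRight z) y (ci _ _).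
  rewrite !bnd_simp => /(_ xy yz) /eqP.
  rewrite subr_eq addrC => /eqP ->; congr +%R.
  rewrite Rintegral_itv_obnd_cbnd//.
  by apply: integrableS (ci y z) => //; exact: subset_itv_oc_cc.
(* The cases follow the signs of [b] and [a]; the third, [b < 0 <= a], contradicts [a <= b]. *)
rewrite /F; case: (leP 0 b) => b0; case: (leP 0 a) => a0.
- by rewrite (split_itv 0 a b)// addrC addKr.
- by rewrite opprK (split_itv a 0 b)// ?(ltW a0)// addrC.
- by have := lt_le_trans b0 (le_trans a0 ab); rewrite ltxx.
- by rewrite opprK addrC (split_itv a b 0) ?(ltW b0)// addrK.
Qed.

Lemma Rintegral_itv_cst (a b r : K) : a <= b ->
  \int[mu]_(x in `[a, b]) r = r * (b - a).
Proof.
move=> ab; rewrite Rintegral_cst//= lebesgue_measure_itv/= lte_fin.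
by case: ltgtP ab => // -> _; rewrite subrr.
Qed.

Context (kappa : K) (c : K -> K).
Hypotheses (kappa1 : 1 < kappa) (cP : wave_speed kappa c).

Let kappa0 : 0 < kappa. Proof. exact: lt_trans kappa1. Qed.
Let cc : continuous c. Proof. by case: cP => /C1_continuous. Qed.

Lemma FB_bounds (a b : K) : a <= b ->
  kappa^-1 * (b - a) <= F c b - F c a <= kappa * (b - a).
Proof.
move=> ab; rewrite FB// -!Rintegral_itv_cst//.
have ici r := @continuous_integrable (cst r) a b (fun=> cvg_cst _).
apply/andP; split; (apply: le_Rintegral; [exact: measurable_itv| |  |]).
all: try by first [exact: ici | exact: continuous_integrable].
all: by move=> x _; have [_ /(_ x) [/andP[]]] := cP.
Qed.

Lemma F_continuous : continuous (F c).
Proof.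
move=> x; apply/cvgrPdist_le => /= e e0.
near=> y; have : `|F c x - F c y| <= kappa * `|x - y|.
  case: (leP y x) => xy.
    have /andP[h1 h2] := FB_bounds xy.
    rewrite !ger0_norm ?subr_ge0//.
    by rewrite -subr_ge0 (le_trans _ h1)// mulr_ge0 ?invr_ge0 ?subr_ge0// ltW.
  have /andP[h1 h2] := FB_bounds (ltW xy).
  rewrite distrC (distrC x) !ger0_norm ?subr_ge0// ?(ltW xy)//.
  by rewrite -subr_ge0 (le_trans _ h1)// mulr_ge0 ?invr_ge0 ?subr_ge0// ltW.
move=> /le_trans; apply; rewrite mulrC -ler_pdivlMr//.
near: y; apply: cvgr_dist_le => //; exact: divr_gt0.
Unshelve. all: by end_near. Qed.

(** A pseudo-inverse cancels on the range, so it remains to show that [F c] is surjective. As [F c]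
    vanishes at 0 and has slope at least [kappa^-1], the value [y] is enclosed by those at [- M] and
    [M] with [M = kappa |y|], and the intermediate value theorem applies. *)
Lemma FinvK : cancel (Finv c) (F c).
Proof.
move=> y; apply: pinvK; rewrite inE/=.
pose M := kappa * `|y|; have M0 : 0 <= M by rewrite mulr_ge0// ltW.
have F0 : F c 0 = 0 by rewrite /F lexx set_itv1 Rintegral_set1.
have h1 : `|y| <= F c M.
  have /andP[+ _] := FB_bounds M0.
  by rewrite F0 !subr0 mulrA mulVf ?gt_eqF// mul1r.
have h2 : F c (- M) <= - `|y|.
  have NM0 : - M <= 0 by rewrite oppr_le0.
  have /andP[+ _] := FB_bounds NM0.
  by rewrite F0 !sub0r opprK mulrA mulVf ?gt_eqF// mul1r lerNr.
have yle : - `|y| <= y <= `|y| by rewrite -ler_norml.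
case/andP: yle => y1 y2.
have [x _ Fx] : exists2 x, x \in `[- M, M] & F c x = y.
  apply: IVT; first by rewrite (le_trans _ M0)// oppr_le0.
    exact/continuous_subspaceT/F_continuous.
  by rewrite ge_min le_max (le_trans h2 y1) (le_trans y2 h1) orbT.
by exists x.
Qed.

(** With [x] and [y] written as values of [F c], this is the lower slope bound of [FB_bounds]. *)
Lemma Finv_lipschitz (x y : K) : `|Finv c x - Finv c y| <= kappa * `|x - y|.
Proof.
rewrite -{2}(FinvK x) -{2}(FinvK y).
move: (Finv c x) (Finv c y) => a b.
wlog ab : a b / a <= b => [wlg|].
  case: (leP a b) => [/wlg//|/ltW/wlg]; by rewrite distrC (distrC (F c b)).
have /andP[h _] := FB_bounds ab.
rewrite distrC (distrC (F c a)) ger0_norm ?subr_ge0//.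
rewrite -ler_pdivrMl// (le_trans h)//; exact: ler_norm.
Qed.

Lemma wave_speed_lipschitz (x y : K) : `|c x - c y| <= kappa * `|x - y|.
Proof.
wlog xy : x y / x <= y => [wlg|].
  case: (leP x y) => [/wlg//|/ltW/wlg]; by rewrite distrC (distrC y).
have [[dc _] cb] := cP.
have [z _ e] : exists2 z, z \in `[x, y] & c y - c x = derive1 c z * (y - x).
  apply: MVT_segment => //; last exact: continuous_subspaceT.
  move=> z _; rewrite derive1E; exact: DeriveDef.
rewrite distrC (distrC x) e normrM ler_wpM2r//.
by have [] := cb z.
Qed.

End wave_speed.

(** * Bounds for the zero-mean primitive *)

Section antiderivative.
Context {K : realType}.
Implicit Types (f g : K -> K).
Local Notation mu := (@lebesgue_measure K).
Local Notation integrable01 f := (mu.-integrable torus (EFin \o f)).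
Local Notation mt := (@measurable_torus K).

Lemma integrable01B f g : integrable01 f -> integrable01 g ->
  integrable01 (f \- g).
Proof. by move=> fi gi; have := integrableB mt fi gi. Qed.

Lemma integrable01_norm f : integrable01 f -> integrable01 (fun x => `|f x|).
Proof. by move=> fi; exact: (integrable_abse fi). Qed.

Lemma subset_torus (x : K) : torus x -> `[0, x] `<=` torus.
Proof.
rewrite /torus/= in_itv/= => /andP[_ x1] y /=.
by rewrite !in_itv/= => /andP[-> yx]/=; exact: le_trans x1.
Qed.

Lemma integrable_torus_sub f (x : K) : torus x -> integrable01 f ->
  mu.-integrable `[0, x] (EFin \o f).
Proof.
move=> x01; apply: integrableS; [exact: mt|exact: measurable_itv|].
exact: subset_torus.
Qed.

Lemma antiderivative0_integrable f : integrable01 f ->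
  integrable01 (antiderivative0 f).
Proof.
move=> fi; apply: continuous_compact_integrable; first exact: segment_compact.
have -> : antiderivative0 f = (fun x => \int[mu]_(y in `[0, x]) f y) -
    (fun x : K => x * \int[mu]_(y in torus) f y) by [].
apply: within_continuousB; first exact: parameterized_integral_continuous.
by apply: continuous_subspaceT => x; exact: cvgMl.
Qed.

Lemma antiderivative0B f g (x : K) : integrable01 f -> integrable01 g ->
  torus x ->
  antiderivative0 (f \- g) x = antiderivative0 f x - antiderivative0 g x.
Proof.
move=> fi gi x01; rewrite /antiderivative0 !RintegralB//; last 3 first.
- exact: mt.
- exact: integrable_torus_sub.
- exact: integrable_torus_sub.
by rewrite mulrBr !opprB addrACA [RHS]addrACA (addrC (- _)).
Qed.

Lemma antiderivativeB f g (x : K) : integrable01 f -> integrable01 g ->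
  torus x ->
  antiderivative (f \- g) x = antiderivative f x - antiderivative g x.
Proof.
move=> fi gi x01; rewrite /antiderivative antiderivative0B//.
have -> : \int[mu]_(y in torus) antiderivative0 (f \- g) y =
    \int[mu]_(y in torus) (antiderivative0 f y - antiderivative0 g y).
  by apply: eq_Rintegral => y /set_mem y01; exact: antiderivative0B.
rewrite RintegralB//; first by rewrite !opprB addrACA [RHS]addrACA (addrC (- _)).
- exact: mt.
- exact: antiderivative0_integrable.
- exact: antiderivative0_integrable.
Qed.

(** The partial integral and the linear correction each contribute at most the L^1 norm, since
    [0 <= x <= 1]. *)
Lemma normr_antiderivative0 f (x : K) : integrable01 f -> torus x ->
  `|antiderivative0 f x| <= 2 * \int[mu]_(y in torus) `|f y|.
Proof.
move=> fi x01; have fni := integrable01_norm fi.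
rewrite /antiderivative0 (le_trans (ler_normB _ _))// mulrDl mul1r lerD//.
  rewrite (le_trans (le_normr_Rintegral _ _))//; first exact: integrable_torus_sub.
  rewrite /Rintegral fine_le//.
  - apply: integrable_fin_num => //; exact: integrable_torus_sub.
  - by apply: integrable_fin_num => //; exact: mt.
  - apply: ge0_subset_integral => //; first exact: mt.
    by case/integrableP: fni.
    exact: subset_torus.
rewrite normrM (le_trans (ler_wpM2l _ (le_normr_Rintegral mt fi)))//.
rewrite ler_piMl ?Rintegral_ge0//.
by move: x01; rewrite /torus/= in_itv/= => /andP[x0 x1]; rewrite ger0_norm.
Qed.

(** Subtracting the mean over a set of measure 1 costs a second copy of the bound for
    [antiderivative0]. *)
Lemma normr_antiderivative f (x : K) : integrable01 f -> torus x ->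
  `|antiderivative f x| <= 4 * \int[mu]_(y in torus) `|f y|.
Proof.
move=> fi x01; rewrite /antiderivative (le_trans (ler_normB _ _))//.
rewrite (_ : 4 = 2 + 2); last by rewrite -natrD.
rewrite mulrDl lerD// ?normr_antiderivative0//.
have Ai := antiderivative0_integrable fi.
rewrite (le_trans (le_normr_Rintegral mt Ai))//.
apply: (@le_trans _ _ (\int[mu]_(y in torus)
  (2 * \int[mu]_(y in torus) `|f y|))).
  apply: le_Rintegral.
  - exact: mt.
  - exact: integrable01_norm.
  - by apply: continuous_integrable => ?; exact: cvg_cst.
  - by move=> y; exact: normr_antiderivative0.
rewrite Rintegral_cst; last exact: mt.
by rewrite [X in _ * fine X](_ : _ = 1%E) ?mulr1//; exact: mu_torus.
Qed.

(** The integrand of [profile], named so that [profile c f g x] unfolds to [Finv c (antiderivative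
    (half_diff f g) x)]. *)
Definition half_diff f g : K -> K := fun y => (f y - g y) / 2.

Lemma half_diff_integrable f g : integrable01 f -> integrable01 g ->
  integrable01 (half_diff f g).
Proof.
move=> fi gi; rewrite (_ : EFin \o _ = fun x => 2^-1%:E * (EFin \o (f \- g)%R) x)%E.
  apply: integrableZl; first exact: mt.
  exact: integrable01B.
by apply/funext => x /=; rewrite /half_diff mulrC.
Qed.

Definition Rnorm1 f : K := \int[mu]_(y in torus) `|f y|.

Lemma Rnorm1E f : integrable01 f -> (Rnorm1 f)%:E = normL 1 f.
Proof.
move=> fi; rewrite normL1E /Rnorm1 /Rintegral fineK//.
by apply: integrable_fin_num; [exact: mt|exact: integrable01_norm].
Qed.

Lemma antiderivative_half_diff R1 R2 S1 S2 (x : K) :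
  integrable01 R1 -> integrable01 R2 -> integrable01 S1 -> integrable01 S2 ->
  torus x ->
  `|antiderivative (half_diff R1 S1) x - antiderivative (half_diff R2 S2) x| <=
    2 * (Rnorm1 (R1 \- R2) + Rnorm1 (S1 \- S2)).
Proof.
move=> iR1 iR2 iS1 iS2 x01.
have h1 := half_diff_integrable iR1 iS1.
have h2 := half_diff_integrable iR2 iS2.
rewrite -antiderivativeB// (le_trans (normr_antiderivative _ _))//.
  exact: integrable01B.
have iR := integrable01_norm (integrable01B iR1 iR2).
have iS := integrable01_norm (integrable01B iS1 iS2).
(* One factor 2 stays in the bound; the other is absorbed by the division by 2 in [half_diff]. *)
rewrite (_ : 4 = 2 * 2); last by rewrite -natrM.
rewrite -mulrA ler_wpM2l// -(RintegralZl _ mt); last first.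
  exact: integrable01_norm (integrable01B h1 h2).
rewrite /Rnorm1 -(RintegralD mt)//; apply: le_Rintegral => //.
- exact: mt.
- rewrite (_ : EFin \o _ = fun x => 2%:E * (EFin \o
     (fun y => `|(half_diff R1 S1 \- half_diff R2 S2) y|)%R) x)%E//.
  apply: integrableZl; first exact: mt.
  exact: integrable01_norm (integrable01B h1 h2).
- exact: (integrableD mt iR iS).
move=> y _; rewrite -[X in X * _]ger0_norm// -normrM /half_diff /=.
rewrite -mulrBl mulrC divfK ?pnatr_eq0//.
have -> : R1 y - S1 y - (R2 y - S2 y) = R1 y - R2 y - (S1 y - S2 y).
  by rewrite !opprB addrACA [RHS]addrACA (addrC (- _)).
exact: ler_normB.
Qed.

End antiderivative.

(** * Smooth periodic approximations of the indicator of [[0, b]] *)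

Section test_functions.
Context {K : realType}.
Implicit Types (f g : K -> K).

Lemma C1_comp f g : C1 f -> C1 g -> C1 (f \o g).
Proof.
move=> [df cf] [dg cg]; split=> [x|].
  exact/derivable1_diffP/differentiable_comp/derivable1_diffP/df/derivable1_diffP.
have -> : derive1 (f \o g) = (derive1 f \o g) \* derive1 g.
  by apply/funext => x; rewrite derive1_comp.
move=> x; apply: continuousM; last exact: cg.
apply: continuous_comp; last exact: cf.
exact: (C1_continuous (conj dg cg)).
Qed.

Lemma C1_expR : C1 (@expR K).
Proof.
split=> [x|]; first exact: derivable_expR.
rewrite (_ : derive1 _ = expR); first exact: continuous_expR.
by apply/funext => x; rewrite derive1E; exact: derive_val.
Qed.

Lemma C1_cos : C1 (@cos K).
Proof.
split=> [x|]; first exact: derivable_cos.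
rewrite (_ : derive1 _ = \- sin).
  by move=> x; apply: continuousN; exact: continuous_sin.
by apply/funext => x; rewrite derive1E; exact: derive_val.
Qed.

(** These maps link the exponentials and the cosine in [smooth_step], so that [C1_comp] gives its
    regularity; [affine 0 1] also serves as the constant test function 1. *)
Definition affine (a b x : K) : K := a * x + b.

Lemma C1_affine (a b : K) : C1 (affine a b).
Proof.
have d (x : K) : is_derive x 1 (affine a b) a.
  by rewrite /affine; apply: is_derive_eq; rewrite addr0 /GRing.scale/= mulr1.
split=> [x|]; first exact: ex_derive.
rewrite (_ : derive1 _ = cst a); first by move=> x; exact: cvg_cst.
by apply/funext => x; rewrite derive1E; exact: derive_val.
Qed.

(* The argument of the double exponential is [n] times
   [2 sin (pi x) sin (pi (x - b))], which is 1-periodic, negative on ]0, b[ and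
   positive on ]b, 1[; see [smooth_stepE]. *)
Definition smooth_step (n : nat) (b : K) : K -> K :=
  expR \o affine (-1) 0 \o expR \o affine (- n%:R) (n%:R * cos (pi * b)) \o
  cos \o affine (pi *+ 2) (- (pi * b)).

Lemma C1_smooth_step n (b : K) : C1 (smooth_step n b).
Proof.
apply: C1_comp (C1_affine _ _); apply: C1_comp C1_cos.
apply: C1_comp (C1_affine _ _); apply: C1_comp C1_expR.
exact: C1_comp C1_expR (C1_affine _ _).
Qed.

Lemma smooth_step_periodic n (b x : K) :
  smooth_step n b (x + 1) = smooth_step n b x.
Proof.
rewrite /smooth_step /=; congr (expR (affine _ _ (expR (affine _ _ _)))).
by rewrite /affine mulrDr mulr1 addrAC cosD2pi.
Qed.

Lemma smooth_step_bounds n (b x : K) : 0 <= smooth_step n b x <= 1.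
Proof.
rewrite /smooth_step /= expR_ge0/= -[leRHS]expR0 ler_expR /affine addr0 mulN1r.
by rewrite oppr_le0 expR_ge0.
Qed.

(** This is [cos (s - t) - cos (s + t) = 2 sin s sin t] at [s = pi x] and [t = pi (y - x)]. The
    product form reveals the sign of the argument in [smooth_step]. *)
Lemma cosB_sin (x y : K) :
  cos (pi *+ 2 * x - pi * y) - cos (pi * y) = 2 * sin (pi * x) * sin (pi * (y - x)).
Proof.
have -> : pi *+ 2 * x - pi * y = pi * x - pi * (y - x).
  by rewrite mulrBr opprB addrA -mulrDl.
have -> : cos (pi * y) = cos (pi * x + pi * (y - x)).
  by rewrite -mulrDr addrC subrK.
by rewrite cosB cosD opprB addrC addrA subrK -mulr2n -mulrA mulr_natl.
Qed.

Lemma smooth_stepE n (b x : K) : smooth_step n b x =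
  expR (- (expR (- (2 * sin (pi * x) * sin (pi * (b - x)))) ^+ n)).
Proof.
rewrite /smooth_step/= {1}/affine addr0 mulN1r -expRM_natl; congr (expR (- expR _)).
by rewrite /affine -cosB_sin mulNr addrC -mulrBr opprB.
Qed.

(** Let [w = 2 sin (pi x) sin (pi (b - x))]. Left of [b] one has [w > 0], so the powers of
    [exp (- w)] tend to 0 and the outer exponential to 1; right of [b] one has [w < 0] and these
    powers blow up. At 0, [b] and 1, [w = 0] and the sequence is constantly [exp (-1)], hence the
    exclusions. *)
Lemma smooth_step_cvg (b x : K) : 0 < b < 1 -> 0 < x < 1 -> x != b ->
  smooth_step n b x @[n --> \oo] --> ((\1_(`[0, b]) x) : K).
Proof.
move=> /andP[b0 b1] /andP[x0 x1] xb.
have sx : 0 < sin (pi * x).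
  by rewrite sin_gt0_pi// mulr_gt0 ?pi_gt0//= gtr_pMr ?pi_gt0.
under eq_fun do rewrite smooth_stepE.
set w := 2 * _ * _; rewrite indicE.
have [xb'|bx] := ltP x b.
  have w0 : 0 < w.
    rewrite /w !mulr_gt0// sin_gt0_pi// mulr_gt0 ?pi_gt0 ?subr_gt0//=.
    by rewrite gtr_pMr ?pi_gt0// ltrBlDr (lt_trans b1)// ltrDl.
  rewrite mem_set/=; last by rewrite in_itv/= !ltW.
  rewrite -[1%:R]expR0 -oppr0.
  apply: (continuous_cvg _ (@continuous_expR K _)); apply: cvgN.
  by apply: cvg_expr; rewrite ger0_norm ?expR_ge0// -[ltRHS]expR0 ltr_expR oppr_lt0.
have {xb}bx : b < x by rewrite lt_neqAle eq_sym xb.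
have w0 : w < 0.
  rewrite /w -(opprB x b) mulrN sinN mulrN oppr_lt0 !mulr_gt0// sin_gt0_pi//.
  rewrite mulr_gt0 ?pi_gt0 ?subr_gt0//=.
  by rewrite gtr_pMr ?pi_gt0// ltrBlDr (lt_trans x1)// ltrDl.
rewrite memNset/=; last by rewrite in_itv/= => /andP[_]; rewrite leNgt bx.
(* With [t = - n w], the inequality [t <= exp t] gives [exp (- exp t) <= exp (- t)], which is the
   n-th power of [exp w < 1]. *)
apply: (@squeeze_cvgr _ _ _ _ (cst 0) (fun n => expR w ^+ n)).
- apply: nearW => n; rewrite expR_ge0/= -!expRM_natl ler_expR mulrN lerNl.
  by rewrite (le_trans _ (expR_ge1Dx _))// lerDr.
- exact: cvg_cst.
- by apply: cvg_expr; rewrite ger0_norm ?expR_ge0// -[ltRHS]expR0 ltr_expR.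
Qed.

End test_functions.

(** * Uniqueness and linearity of the weak derivative *)

Section weak_derivative.
Context {K : realType}.
Implicit Types (f g h : K -> K).
Local Notation mu := (@lebesgue_measure K).
Local Notation integrable01 f := (mu.-integrable torus (EFin \o f)).
Local Notation mt := (@measurable_torus K).

Lemma integrable01M_continuous h g : integrable01 h -> continuous g ->
  integrable01 (fun x => h x * g x).
Proof.
move=> hi gc; have gb : [bounded g x | x in (torus : set K)].
  have : compact (g @` torus).
    by apply: continuous_compact; [exact: continuous_subspaceT|exact: segment_compact].
  move/compact_bounded => [M [Mr gM]]; exists M; split=> // N MN x Tx.
  by apply: (gM _ MN); exists x.
rewrite (_ : EFin \o _ = (EFin \o g) \* (EFin \o h))%E.
  apply: integrableMr => //; first exact: mt.
  by apply: measurable_funTS; exact: continuous_measurable_fun.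
by apply/funext => x /=; rewrite mulrC.
Qed.

(** Test with [smooth_step n b] and let [n] tend to infinity. The test functions take values in
    [[0, 1]], so [|h|] dominates and the zero integrals converge to the integral over [[0, b]]. *)
Lemma Rintegral_prefix_eq0 h (b : K) : integrable01 h ->
  (forall phi, C1 phi -> (forall x, phi (x + 1) = phi x) ->
    \int[mu]_(x in torus) (h x * phi x) = 0) ->
  0 < b < 1 -> \int[mu]_(x in `[0, b]) h x = 0.
Proof.
move=> hi htest b01.
have sc n : continuous (smooth_step n b) by exact/C1_continuous/C1_smooth_step.
have hsi n := integrable01M_continuous hi (sc n).
pose f_ n (x : K) := (h x * smooth_step n b x)%:E.
have int0 n : (\int[mu]_(x in torus) f_ n x = 0)%E.
  rewrite -[LHS]fineK; last by have := integrable_fin_num mt (hsi n).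
  by congr (_%:E); exact: htest (C1_smooth_step n b) (smooth_step_periodic n b).
have tb : [set` `[0, b]] `<=` (torus : set K).
  apply: subset_itv => //; rewrite bnd_simp; by case/andP: b01 => _ /ltW.
pose f (x : K) := ((h \_ `[0, b]) x)%:E.
have fi : mu.-integrable torus f.
  rewrite /f -[X in mu.-integrable _ X]restrict_EFin.
  have mb : measurable ([set` `[0, b]] : set (measurableTypeR K)).
    exact: measurable_itv.
  have [+ _] := integrable_restrict mu mb mt (EFin \o h); apply; rewrite setIidr//.
  by apply: integrableS hi; [exact: mt|exact: measurable_itv|].
have [] := @dominated_convergence _ _ _ mu torus mt f_ f (fun x => `|h x|%:E).
- by move=> n; case/integrableP: (hsi n).
- by case/integrableP: fi.
(* Pointwise convergence may fail only at 0, [b] and 1, which form a null set. *)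
- have : mu.-negligible ([set 0] `|` [set b] `|` [set 1] : set K).
    have n1 (r : K) : mu.-negligible [set r].
      by apply/negligibleP; [exact: measurable_set1|exact: lebesgue_measure_set1].
    by do !apply: negligibleU.
  apply: negligibleS => x /= /not_implyP[x01 hx]; apply: contrapT => nx; apply: hx.
  apply/fine_cvgP; split; first exact: nearW.
  rewrite (_ : (h \_ `[0, b]) x = h x * \1_(`[0, b]) x); last first.
    by rewrite patchE indicE; case: ifP; rewrite ?mulr1 ?mulr0.
  apply: cvgMr; apply: smooth_step_cvg => //.
    move: x01; rewrite /torus/= in_itv/= => /andP[x0 x1].
    rewrite !lt_neqAle x0 x1 !andbT; apply/andP; split; apply/eqP => e.
      by apply: nx; left; left.
    by apply: nx; right.
  by apply/eqP => e; apply: nx; left; right.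
- exact: (integrable_abse hi).
- apply: nearW => x n _; rewrite lee_fin normrM ler_piMr//.
  by have /andP[s0 s1] := smooth_step_bounds n b x; rewrite ger0_norm.
move=> _ _; under eq_fun do rewrite int0.
move=> /(@cvg_unique _ (@ereal_hausdorff K) _ _ _ _ (cvg_cst 0%E)) e.
rewrite -[X in Rintegral _ X _](setIidr tb) Rintegral_mkcondr /Rintegral.
by rewrite -/f -e.
Qed.

(** The primitive from minus infinity of [h] extended by zero vanishes identically, while almost
    everywhere its derivative is that extension. *)
Lemma ae_eq0_periodic_test h : integrable01 h ->
  (forall phi, C1 phi -> (forall x, phi (x + 1) = phi x) ->
    \int[mu]_(x in torus) (h x * phi x) = 0) ->
  {ae mu, forall x, (h \_ torus) x = 0}.
Proof.
move=> hi htest.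
have total0 : \int[mu]_(x in torus) h x = 0.
  rewrite -(htest (affine 0 1) (C1_affine _ _)); last first.
    by move=> x; rewrite /affine !mul0r.
  by apply: eq_Rintegral => x _; rewrite /affine mul0r add0r mulr1.
have hTi : mu.-integrable setT (EFin \o (h \_ torus)).
  by rewrite -restrict_EFin; apply: (iffLR (integrable_mkcond _ mt)).
have := @FTC1Ny K (h \_ torus) _ _.
have -> : (fun x => \int[mu]_(t in `]-oo, x]) (h \_ torus) t) = cst 0.
  apply/funext => x; rewrite /cst -Rintegral_mkcondr.
  (* For [x < 0] the domain is empty, for [1 <= x] it is the whole torus, where [total0] applies,
     and in between it is a prefix [[0, x]], reduced to a point when [x = 0]. *)
  have [x0|x0] := ltP x 0.
    rewrite (_ : _ `&` _ = set0) ?Rintegral_set0//.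
    apply/seteqP; split=> // y []/=; rewrite /torus/= !in_itv/= => yx /andP[y0 _].
    by have := le_lt_trans (le_trans y0 yx) x0; rewrite ltxx.
  have [x1|x1] := ltP x 1; last first.
    rewrite setIidr// => y; rewrite /torus/= !in_itv/= => /andP[_ y1].
    exact: le_trans x1.
  rewrite (_ : _ `&` _ = `[0, x]%classic); last first.
    apply/seteqP; split=> y; rewrite /torus/= !in_itv/=.
      by move=> [-> /andP[-> _]].
    by move=> /andP[-> yx]; rewrite yx (le_trans yx (ltW x1)).
  have [->|xn0] := eqVneq x 0; first by rewrite set_itv1 Rintegral_set1.
  by rewrite Rintegral_prefix_eq0// x1 lt_neqAle eq_sym xn0 x0.
move=> /(_ _ _)/=.
have fin y : mu.-integrable `]-oo, y] (EFin \o (h \_ torus)).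
  apply: integrableS hTi => //.
move=> /(_ fin) /(_ (open_integrable_locally openT hTi)).
apply: filterS; first exact: (ae_filter_ringOfSetsType mu).
by move=> x [_]; rewrite derive1_cst => <-.
Qed.

(** Subtracting the two defining identities shows that [g1 - g2] is orthogonal to every periodic C^1
    function. *)
Lemma weak_derivative_ae_unique f g1 g2 : inL2 g1 -> inL2 g2 ->
  is_weak_derivative f g1 -> is_weak_derivative f g2 ->
  {ae mu, forall x, ((g1 \- g2) \_ torus) x = 0}.
Proof.
move=> /inL2_integrable i1 /inL2_integrable i2 w1 w2.
apply: ae_eq0_periodic_test; first exact: integrable01B.
move=> phi phi1 phiT; have phic := C1_continuous phi1.
under eq_Rintegral do rewrite /= mulrBl.
rewrite RintegralB//; [|exact: mt|exact: integrable01M_continuous..].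
by rewrite -[X in X - _]opprK -w1// w2// opprK subrr.
Qed.

Lemma is_weak_derivativeB f1 f2 g1 g2 : inL2 f1 -> inL2 f2 -> inL2 g1 -> inL2 g2 ->
  is_weak_derivative f1 g1 -> is_weak_derivative f2 g2 ->
  is_weak_derivative (f1 \- f2) (g1 \- g2).
Proof.
move=> /inL2_integrable fi1 /inL2_integrable fi2 /inL2_integrable gi1
  /inL2_integrable gi2 w1 w2 phi phi1 phiT.
have phic := C1_continuous phi1; have phic' := phi1.2.
have B u v psi : integrable01 u -> integrable01 v -> continuous psi ->
    \int[mu]_(x in torus) ((u \- v) x * psi x) =
    \int[mu]_(x in torus) (u x * psi x) - \int[mu]_(x in torus) (v x * psi x).
  move=> ui vi psic; under eq_Rintegral do rewrite /= mulrBl.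
  by rewrite RintegralB//; [exact: mt|exact: integrable01M_continuous..].
by rewrite !B// w1// w2// opprB opprK addrC.
Qed.

(** Membership in H^1 makes the set of candidates nonempty, so [xget] returns one of them and not
    its default. *)
Lemma weak_derivativeP f : inH1 f ->
  inL2 (weak_derivative f) /\ is_weak_derivative f (weak_derivative f).
Proof.
by move=> [_ [g gP]]; exact: (@xgetPex _ (cst 0)
  [set g | inL2 g /\ is_weak_derivative f g] (ex_intro _ g gP)).
Qed.

Lemma inH1B f1 f2 : inH1 f1 -> inH1 f2 -> inH1 (f1 \- f2).
Proof.
move=> h1 h2; have [d1 w1] := weak_derivativeP h1; have [d2 w2] := weak_derivativeP h2.
split; first by apply: inL2B; [exact: h1.1|exact: h2.1].
exists (weak_derivative f1 \- weak_derivative f2); split; first exact: inL2B.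
by apply: is_weak_derivativeB => //; [exact: h1.1|exact: h2.1].
Qed.

Lemma normL2_ae_eq f g : inL2 f -> inL2 g ->
  {ae mu, forall x, ((f \- g) \_ torus) x = 0} -> normL 2%:E f = normL 2%:E g.
Proof.
move=> hf hg fg; rewrite /normL unlock; congr (poweR _ _).
have m u : inL2 u ->
    measurable_fun setT (fun x => `|(EFin \o u \_ torus) x| `^ 2)%E.
  move=> /inL2_measurable mu_; apply/measurable_EFinP.
  apply: (measurableT_comp (measurable_powR _)) => //; exact: measurableT_comp.
apply: ae_eq_integral => //; [exact: m|exact: m|].
apply: filterS fg; first exact: (ae_filter_ringOfSetsType mu).
move=> x + _ /=; rewrite !patchE; case: ifP => //= _ /eqP.
by rewrite subr_eq0 => /eqP ->.
Qed.

(** The choice made by [xget] need not be linear, but both functions are weak derivatives of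
    [f1 - f2], hence agree almost everywhere. *)
Lemma normL2_weak_derivativeB f1 f2 : inH1 f1 -> inH1 f2 ->
  normL 2%:E (weak_derivative f1 \- weak_derivative f2) =
  normL 2%:E (weak_derivative (f1 \- f2)).
Proof.
move=> h1 h2; have [d1 w1] := weak_derivativeP h1; have [d2 w2] := weak_derivativeP h2.
have [d w] := weak_derivativeP (inH1B h1 h2).
apply: normL2_ae_eq => //; first exact: inL2B.
apply: weak_derivative_ae_unique w => //; first exact: inL2B.
by apply: is_weak_derivativeB => //; [exact: h1.1|exact: h2.1].
Qed.

(** Each entry is the square root of its own square, and the square root is monotone on nonnegative
    extended reals. *)
Lemma poweR_sq_sum_ge (x y : \bar K) : (0 <= x)%E -> (0 <= y)%E ->
  (x <= (x `^ 2 + y `^ 2) `^ 2^-1)%E /\ (y <= (x `^ 2 + y `^ 2) `^ 2^-1)%E.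
Proof.
have E z : (0 <= z)%E -> ((z `^ 2) `^ 2^-1 = z)%E.
  by move=> z0; rewrite -poweRrM mulfV ?pnatr_eq0// poweRe1.
move=> x0 y0; split; [rewrite -[leLHS]E//|rewrite -[leLHS]E//].
all: apply: gt0_ler_poweR; rewrite ?invr_ge0// ?in_itv/= ?leey ?andbT.
all: rewrite ?adde_ge0 ?poweR_ge0//.
- by rewrite leeDl// poweR_ge0.
- by rewrite leeDr// poweR_ge0.
Qed.

Lemma normL2_le_normH1 f : (normL 2%:E f <= normH1 f)%E.
Proof.
by have [] := poweR_sq_sum_ge (Lnorm_ge0 mu 2%:E (EFin \o (f \_ torus)))
  (Lnorm_ge0 mu 2%:E (EFin \o (weak_derivative f \_ torus))).
Qed.

Lemma normL2_weak_derivative_le_normH1 f :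
  (normL 2%:E (weak_derivative f) <= normH1 f)%E.
Proof.
by have [] := poweR_sq_sum_ge (Lnorm_ge0 mu 2%:E (EFin \o (f \_ torus)))
  (Lnorm_ge0 mu 2%:E (EFin \o (weak_derivative f \_ torus))).
Qed.

End weak_derivative.

(** * Uniform bound on profiles and product estimates *)

Section estimates.
Context {K : realType}.
Implicit Types (f g c u P R S : K -> K).
Local Notation mu := (@lebesgue_measure K).
Local Notation N2 f := (normL 2%:E f).

Lemma lipschitz_constant_ge0 g : (0 <= lipschitz_constant g)%E.
Proof.
(* A supremum over no pairs would be minus infinity; the pair [(0, 1)] supplies a nonnegative
   member. *)
apply: (@le_trans _ _ (`|g 0 - g 1| / `|0 - 1|)%:E).
  by rewrite lee_fin divr_ge0.
by apply: ereal_sup_ubound; exists (0, 1) => //=; rewrite eq_sym oner_eq0.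
Qed.

Lemma lipschitz_constantP g (x y : K) :
  (`|g x - g y|%:E <= lipschitz_constant g * `|x - y|%:E)%E.
Proof.
(* The supremum ranges over distinct points only. On the diagonal both sides are 0, even for an
   infinite constant, since infinity times 0 is 0. *)
have [->|xy] := eqVneq x y.
  by rewrite !subrr normr0 mule0.
have xy0 : 0 < `|x - y| by rewrite normr_gt0 subr_eq0.
rewrite -(divfK (lt0r_neq0 xy0) `|g x - g y|) EFinM lee_wpmul2r ?lee_fin//.
by apply: ereal_sup_ubound; exists (x, y).
Qed.

Lemma normLy_profileB c R1 R2 S1 S2 : inL2 R1 -> inL2 R2 -> inL2 S1 -> inL2 S2 ->
  (normL +oo (profile c R1 S1 \- profile c R2 S2)%R <=
   2%:E * lipschitz_constant (Finv c) *
     (normL 1 (R1 \- R2)%R + normL 1 (S1 \- S2)%R))%E.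
Proof.
move=> hR1 hR2 hS1 hS2; have L0 := lipschitz_constant_ge0 (Finv c).
rewrite -(muleC (lipschitz_constant _)) -muleA.
have iR := inL2_integrable (inL2B hR1 hR2).
have iS := inL2_integrable (inL2B hS1 hS2).
rewrite -!Rnorm1E// -EFinD -EFinM.
have n0 : 0 <= 2 * (Rnorm1 (R1 \- R2) + Rnorm1 (S1 \- S2)).
  by rewrite mulr_ge0// addr_ge0// Rintegral_ge0.
(* The norm at [+oo] is an essential supremum, with the value 0 in the branch of a null space; a
   pointwise bound settles the former. *)
rewrite /normL unlock; case: ifPn => _; last by rewrite mule_ge0// lee_fin.
apply/ess_supP/nearW => x /=; rewrite patchE; case: ifPn => [/set_mem x01|_].
  have lip := lipschitz_constantP (Finv c)
    (antiderivative (half_diff R1 S1) x) (antiderivative (half_diff R2 S2) x).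
  apply: (le_trans lip); rewrite lee_wpmul2l// lee_fin.
  by apply: antiderivative_half_diff => //; exact: inL2_integrable.
by rewrite normr0 mule_ge0// lee_fin.
Qed.

Lemma eq_normL2 f g : (forall x, torus x -> `|f x| = `|g x|) -> N2 f = N2 g.
Proof.
by move=> fg; apply/eqP; rewrite eq_le !le_normL2// => x /fg ->.
Qed.

Lemma inL2_norm f : inL2 f -> inL2 (fun x => `|f x|).
Proof.
move=> hf; have fin := normL2_fin hf.
rewrite /inL2 inE; apply/andP; split; rewrite inE/=.
  rewrite (_ : _ \_ _ = Num.norm \o (f \_ torus)).
    by apply: measurableT_comp => //; exact: inL2_measurable.
  by apply/funext => x; rewrite /= !patchE; case: ifP; rewrite ?normr0.
rewrite /finite_norm -/(N2 (fun x => `|f x|)%R) (@eq_normL2 _ f).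
  by rewrite -ge0_fin_numE ?Lnorm_ge0.
by move=> x _; rewrite normr_id.
Qed.

Section product.
Context (kappa L : K) (c u1 u2 P1 P2 : K -> K).
Hypotheses (kappa1 : 1 < kappa) (cP : wave_speed kappa c) (L0 : 0 <= L).
Hypothesis (cu : forall x, torus x -> `|c (u1 x) - c (u2 x)| <= L).
Hypotheses (h1 : inL2 P1) (h2 : inL2 P2).

(** The integrand is dominated pointwise by [kappa |P1 - P2| + L |P2|], and Minkowski's inequality
    is applied to this dominating sum of L^2 functions. The absolute values are put inside the norms
    beforehand for that purpose. *)
Lemma normL2_speed_mulB_r :
  (N2 (fun x => c (u1 x) * P1 x - c (u2 x) * P2 x)%R <=
   kappa%:E * N2 (P1 \- P2)%R + L%:E * N2 P2)%E.
Proof.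
have kappa0 : 0 < kappa by exact: lt_trans kappa1.
have hd := inL2_norm (inL2B h1 h2); have h2n := inL2_norm h2.
have e1 : N2 (P1 \- P2) = N2 (fun x => `|(P1 \- P2) x|).
  by apply: eq_normL2 => x _; rewrite normr_id.
have e2 : N2 P2 = N2 (fun x => `|P2 x|).
  by apply: eq_normL2 => x _; rewrite normr_id.
rewrite e1 e2 -{1}(gtr0_norm kappa0) -{1}(ger0_norm L0) -!normL2Z//.
apply: le_trans (normL2D (inL2Z _ hd) (inL2Z _ h2n)).
apply: le_normL2 => x x01 /=; rewrite [leRHS]ger0_norm; last first.
  by rewrite addr_ge0// mulr_ge0// ltW.
have -> : c (u1 x) * P1 x - c (u2 x) * P2 x =
    c (u1 x) * (P1 x - P2 x) + (c (u1 x) - c (u2 x)) * P2 x.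
  by rewrite mulrBr mulrBl addrA subrK.
rewrite (le_trans (ler_normD _ _))// !normrM lerD// ler_wpM2r//; last exact: cu.
have [_ /(_ (u1 x)) [/andP[cl cr] _]] := cP.
by rewrite ger0_norm// (le_trans _ cl)// invr_ge0 ltW.
Qed.

End product.

Lemma normL2_speed_mulB (kappa L : K) c u1 u2 P1 P2 :
  1 < kappa -> wave_speed kappa c -> 0 <= L ->
  (forall x, torus x -> `|c (u1 x) - c (u2 x)| <= L) -> inL2 P1 -> inL2 P2 ->
  (N2 (fun x => c (u1 x) * P1 x - c (u2 x) * P2 x)%R <=
   kappa%:E * N2 (P1 \- P2)%R + L%:E * Order.min (N2 P1) (N2 P2))%E.
Proof.
move=> kappa1 cP L0 cu h1 h2; rewrite /Order.min; case: ifP => _.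
  (* Here [N2 P1] is the smaller norm: exchange the indices 1 and 2, which changes the differences
     only by a sign. *)
  have cu' x : torus x -> `|c (u2 x) - c (u1 x)| <= L by rewrite distrC; exact: cu.
  have := normL2_speed_mulB_r kappa1 cP L0 cu' h2 h1.
  rewrite (@eq_normL2 _ (fun x => c (u1 x) * P1 x - c (u2 x) * P2 x)); last first.
    by move=> x _; rewrite distrC.
  by rewrite (@eq_normL2 (P2 \- P1) (P1 \- P2))// => x _ /=; rewrite distrC.
exact: normL2_speed_mulB_r.
Qed.

(** Common form of (ii) and (iii): the speeds come from [R] and [S], while the factors [P] and [Q]
    are either [R] and [S] themselves or their weak derivatives. [A] and [B] stand for the norms of
    the differences, in L^2 or in H^1. *)
Lemma speed_profile_bound (kappa : K) c R1 R2 S1 S2 P1 P2 Q1 Q2 (A B : \bar K) :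
  1 < kappa -> wave_speed kappa c ->
  inL2 R1 -> inL2 R2 -> inL2 S1 -> inL2 S2 ->
  inL2 P1 -> inL2 P2 -> inL2 Q1 -> inL2 Q2 ->
  A \is a fin_num -> B \is a fin_num ->
  (N2 (R1 \- R2)%R <= A)%E -> (N2 (S1 \- S2)%R <= B)%E ->
  (N2 (P1 \- P2)%R <= A)%E -> (N2 (Q1 \- Q2)%R <= B)%E ->
  (N2 (fun x => c (profile c R1 S1 x) * P1 x -
               c (profile c R2 S2 x) * P2 x)%R +
   N2 (fun x => c (profile c R1 S1 x) * Q1 x -
               c (profile c R2 S2 x) * Q2 x)%R <=
   (kappa + 2 * kappa ^+ 2)%:E *
     (1 + Order.min (N2 P1) (N2 P2) + Order.min (N2 Q1) (N2 Q2)) * (A + B))%E.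
Proof.
move=> kappa1 cP hR1 hR2 hS1 hS2 hP1 hP2 hQ1 hQ2 Afin Bfin RA SB PA QB.
set u1 := profile c R1 S1; set u2 := profile c R2 S2.
have kappa0 : 0 < kappa by exact: lt_trans kappa1.
rewrite -(fineK Afin) -(fineK Bfin) in RA SB PA QB *.
move: (fine A) (fine B) RA SB PA QB => a b RA SB PA QB.
have a0 : 0 <= a by rewrite -lee_fin; exact: le_trans (Lnorm_ge0 _ _ _) RA.
have b0 : 0 <= b by rewrite -lee_fin; exact: le_trans (Lnorm_ge0 _ _ _) SB.
(* One [kappa] is the Lipschitz constant of [c], the other that of [Finv c]; the 2 comes from
   [antiderivative_half_diff]. *)
pose L := kappa * (kappa * (2 * (a + b))).
have L0 : 0 <= L by rewrite !mulr_ge0 ?addr_ge0// ltW.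
have cu x : torus x -> `|c (u1 x) - c (u2 x)| <= L.
  move=> x01; rewrite (le_trans (wave_speed_lipschitz cP _ _))// ler_wpM2l ?(ltW kappa0)//.
  have lip := Finv_lipschitz kappa1 cP
    (antiderivative (half_diff R1 S1) x) (antiderivative (half_diff R2 S2) x).
  apply: (le_trans lip); rewrite ler_wpM2l ?(ltW kappa0)//.
  apply: (@le_trans _ _ (2 * (Rnorm1 (R1 \- R2) + Rnorm1 (S1 \- S2)))).
    by apply: antiderivative_half_diff => //; exact: inL2_integrable.
  have n1 f1 f2 r : inL2 f1 -> inL2 f2 -> (N2 (f1 \- f2)%R <= r%:E)%E ->
      Rnorm1 (f1 \- f2) <= r.
    move=> hf1 hf2; have hf := inL2B hf1 hf2.
    rewrite -lee_fin Rnorm1E; last exact: inL2_integrable.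
    exact: le_trans (normL1_le_normL2 hf).
  by rewrite ler_wpM2l// lerD// n1.
apply: (le_trans (leeD (normL2_speed_mulB kappa1 cP L0 cu hP1 hP2)
                       (normL2_speed_mulB kappa1 cP L0 cu hQ1 hQ2))).
have minfin f g : inL2 f -> inL2 g -> Order.min (N2 f) (N2 g) \is a fin_num.
  by move=> hf hg; rewrite /Order.min; case: ifP => _; exact: normL2_fin.
have min0 f g : (0 <= Order.min (N2 f) (N2 g))%E by rewrite le_min !Lnorm_ge0.
have mP0 := min0 P1 P2; have mQ0 := min0 Q1 Q2.
rewrite -(fineK (minfin _ _ hP1 hP2)) -(fineK (minfin _ _ hQ1 hQ2)) in mP0 mQ0 *.
move: (fine (Order.min (N2 P1) _)) (fine (Order.min (N2 Q1) _)) mP0 mQ0 => mP mQ.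
rewrite !lee_fin => mP0 mQ0.
have h X r m : (X <= r%:E)%E ->
    (kappa%:E * X + L%:E * m%:E <= (kappa * r + L * m)%:E)%E.
  by move=> Xr; rewrite EFinD EFinM leeD// ?EFinM// lee_wpmul2l// lee_fin ltW.
apply: (le_trans (leeD (h _ _ _ PA) (h _ _ _ QB))).
(* All quantities are now real. The left side is [(a + b) (kappa + 2 kappa^2 (mP + mQ))], and the
   slack against the right side is a sum of nonnegative terms. *)
rewrite -!EFinD -!EFinM lee_fin /L -subr_ge0.
rewrite [leRHS](_ : _ = (a + b) * (kappa * (mP + mQ) + 2 * kappa ^+ 2)); last by ring.
have k0 := ltW kappa0; apply: mulr_ge0; first exact: addr_ge0.
apply: addr_ge0; first by apply: mulr_ge0 => //; exact: addr_ge0.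
by apply: mulr_ge0 => //; exact: exprn_ge0.
Qed.

Lemma normH1_fin f : inH1 f -> normH1 f \is a fin_num.
Proof.
move=> hf; have [hd _] := weak_derivativeP hf.
apply: fin_num_poweR; rewrite fin_numD; apply/andP.
split; apply: fin_num_poweR; apply: normL2_fin; [exact: hf.1|exact: hd].
Qed.

End estimates.

Theorem lemma4p1 (K : realType) :
  (exists C : K, 0 < C /\
    forall (kappa : K) (c R1 R2 S1 S2 : K -> K),
      1 < kappa -> wave_speed kappa c ->
      inL2 R1 -> inL2 R2 -> inL2 S1 -> inL2 S2 ->
      let u1 := profile c R1 S1 in
      let u2 := profile c R2 S2 in
      (normL +oo (u1 \- u2)%R <=
       C%:E * lipschitz_constant (Finv c) *
         (normL 1 (R1 \- R2)%R + normL 1 (S1 \- S2)%R))%E)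
  /\
  (forall kappa : K, 1 < kappa -> exists C : K, 0 < C /\
    forall c R1 R2 S1 S2 : K -> K,
      wave_speed kappa c ->
      inL2 R1 -> inL2 R2 -> inL2 S1 -> inL2 S2 ->
      let u1 := profile c R1 S1 in
      let u2 := profile c R2 S2 in
      (normL 2%:E (fun x => c (u1 x) * R1 x - c (u2 x) * R2 x)%R +
       normL 2%:E (fun x => c (u1 x) * S1 x - c (u2 x) * S2 x)%R <=
       C%:E *
         (1 + Order.min (normL 2%:E R1) (normL 2%:E R2)
            + Order.min (normL 2%:E S1) (normL 2%:E S2)) *
         (normL 2%:E (R1 \- R2)%R + normL 2%:E (S1 \- S2)%R))%E)
  /\
  (forall kappa : K, 1 < kappa -> exists C : K, 0 < C /\
    forall c R1 R2 S1 S2 : K -> K,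
      wave_speed kappa c ->
      inH1 R1 -> inH1 R2 -> inH1 S1 -> inH1 S2 ->
      let u1 := profile c R1 S1 in
      let u2 := profile c R2 S2 in
      let dR1 := weak_derivative R1 in
      let dR2 := weak_derivative R2 in
      let dS1 := weak_derivative S1 in
      let dS2 := weak_derivative S2 in
      (normL 2%:E (fun x => c (u1 x) * dR1 x - c (u2 x) * dR2 x)%R +
       normL 2%:E (fun x => c (u1 x) * dS1 x - c (u2 x) * dS2 x)%R <=
       C%:E *
         (1 + Order.min (normL 2%:E dR1) (normL 2%:E dR2)
            + Order.min (normL 2%:E dS1) (normL 2%:E dS2)) *
         (normH1 (R1 \- R2)%R + normH1 (S1 \- S2)%R))%E).
Proof.
split.
  (* The 2 is the 4 of [normr_antiderivative] times the 1/2 in [profile]. *)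
  exists 2; split=> // kappa c R1 R2 S1 S2 _ _ hR1 hR2 hS1 hS2.
  exact: normLy_profileB.
have C0 (kappa : K) : 1 < kappa -> 0 < kappa + 2 * kappa ^+ 2.
  by move=> k1; have k0 := lt_trans ltr01 k1; rewrite addr_gt0// mulr_gt0// exprn_gt0.
split=> kappa kappa1; exists (kappa + 2 * kappa ^+ 2); split; try exact: C0.
  move=> c R1 R2 S1 S2 cP hR1 hR2 hS1 hS2; cbv zeta.
  by apply: speed_profile_bound => //; apply: normL2_fin; exact: inL2B.
move=> c R1 R2 S1 S2 cP hR1 hR2 hS1 hS2; cbv zeta.
have d f : inH1 f -> inL2 (weak_derivative f) by move=> /weak_derivativeP[].
have le f g : inH1 f -> inH1 g ->
    (normL 2%:E (weak_derivative f \- weak_derivative g)%R <= normH1 (f \- g)%R)%E.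
  move=> hf hg; rewrite normL2_weak_derivativeB//.
  exact: normL2_weak_derivative_le_normH1.
(* With [P] and [Q] the weak derivatives, the H^1 norms of the differences bound both the L^2 norms
   that control the speeds and those of the derivative differences. *)
apply: speed_profile_bound => //; try exact: d; try exact: le;
  try exact: normL2_le_normH1; try by apply: normH1_fin; exact: inH1B.
- exact: hR1.1.
- exact: hR2.1.
- exact: hS1.1.
- exact: hS2.1.
Qed.
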